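(* Let $n\ge1$. Every finitely generated extension $\mathcal{L}$ of $\mathrm{BD}_1$ with the $n$-PCP is the smallest among the extensions of $\mathrm{BD}_1$ with the $n$-PCP which validate a certain finite set of finitary rules.
   Context: Formulas are built from variables using $\wedge,\vee,\neg$. A structure is a pair $\langle\mathbf{A},F\rangle$, $F\subseteq A$; a rule $\Gamma\vdash\varphi$ is valid in it if every homomorphism $v$ from the formula algebra with $v[\Gamma]\subseteq F$ has $v(\varphi)\in F$. A logic is a substitution-invariant consequence relation; a finitely generated logic is one determined by a finite set of finite structures; a finitary rule has finitely many premises. $\mathrm{BD}_1$ (Belnap–Dunn logic) is the logic determined by all $\langle\mathbf{A},F\rangle$ with $\mathbf{A}$ a De~Morgan lattice (distributive lattice with $\neg$, $\neg\neg x=x$, De~Morgan laws) and $F$ a lattice filter. $\mathcal{L}$ has the $n$-PCP if for all $\Gamma,\varphi_1,\dots,\varphi_{n+1},\psi$: whenever $\Gamma,\bigvee_{j\ne i}\varphi_j\vdash_{\mathcal{L}}\psi$ for each $i\in\{1,\dots,n+1\}$, then $\Gamma,\varphi_1\vee\dots\vee\varphi_{n+1}\vdash_{\mathcal{L}}\psi$. *)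

(* Defs.v *)
From mathcomp Require Import all_boot.
From mathcomp Require Import boolp classical_sets functions cardinality.

Set Implicit Arguments.
Unset Strict Implicit.
Unset Printing Implicit Defensive.

Local Open Scope classical_set_scope.

(* Algebras in the signature (meet, join, neg); no equations are assumed. *)
Record algebra := Algebra {
  carrier :> Type;
  ameet : carrier -> carrier -> carrier;
  ajoin : carrier -> carrier -> carrier;
  aneg : carrier -> carrier;
  alg_nonempty : inhabited carrier }.

Definition homomorphism (A B : algebra) (f : A -> B) : Prop :=
  [/\ forall x y, f (ameet x y) = ameet (f x) (f y),
      forall x y, f (ajoin x y) = ajoin (f x) (f y) &
      forall x, f (aneg x) = aneg (f x)].

Inductive formula :=
  | Var of nat
  | And of formula & formula
  | Or of formula & formula
  | Neg of formula.

Definition formula_algebra : algebra :=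
  @Algebra formula And Or Neg (inhabits (Var 0)).

Record structure := Structure {
  str_alg :> algebra;
  designated : set str_alg }.

Definition valid (M : structure) (Gamma : set formula) (phi : formula) : Prop :=
  forall v : formula_algebra -> M, homomorphism v ->
    v @` Gamma `<=` designated (s := M) -> designated (v phi).

Record logic := Logic {
  entails :> set formula -> formula -> Prop;
  entails_refl : forall (Gamma : set formula) phi, Gamma phi -> entails Gamma phi;
  entails_mono : forall (Gamma Delta : set formula) phi,
    Gamma `<=` Delta -> entails Gamma phi -> entails Delta phi;
  entails_cut : forall (Gamma Delta : set formula) phi,
    (forall delta, Delta delta -> entails Gamma delta) ->
    entails Delta phi -> entails Gamma phi;
  entails_subst : forall sigma : formula_algebra -> formula_algebra,
    homomorphism sigma -> forall (Gamma : set formula) phi,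
    entails Gamma phi -> entails (sigma @` Gamma) (sigma phi) }.

Section LogicOf.
Variable K : set structure.

Definition valid_in_all (Gamma : set formula) (phi : formula) : Prop :=
  forall M, K M -> valid M Gamma phi.

Lemma valid_in_all_refl (Gamma : set formula) phi :
  Gamma phi -> valid_in_all Gamma phi.
Proof. by move=> Gphi M _ v _; apply; exists phi. Qed.

Lemma valid_in_all_mono (Gamma Delta : set formula) phi :
  Gamma `<=` Delta -> valid_in_all Gamma phi -> valid_in_all Delta phi.
Proof.
move=> sGD GP M KM v hv vD; apply: (GP M KM v hv) => _ [x Gx <-].
by apply: vD; exists x => //; apply: sGD.
Qed.

Lemma valid_in_all_cut (Gamma Delta : set formula) phi :
  (forall delta, Delta delta -> valid_in_all Gamma delta) ->
  valid_in_all Delta phi -> valid_in_all Gamma phi.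
Proof.
move=> GD DP M KM v hv vG; apply: (DP M KM v hv) => _ [x Dx <-].
exact: (GD x Dx M KM v hv vG).
Qed.

Lemma valid_in_all_subst (sigma : formula_algebra -> formula_algebra) :
  homomorphism sigma -> forall (Gamma : set formula) phi,
  valid_in_all Gamma phi -> valid_in_all (sigma @` Gamma) (sigma phi).
Proof.
move=> [sm sj sn] Gamma phi GP M KM v [vm vj vn] vG.
apply: (GP M KM (fun x => v (sigma x))).
  by split=> [x y|x y|x]; rewrite ?sm ?sj ?sn ?vm ?vj ?vn.
by move=> _ [x Gx <-]; apply: vG; exists (sigma x) => //; exists x.
Qed.

Definition logic_of : logic :=
  @Logic valid_in_all valid_in_all_refl valid_in_all_mono valid_in_all_cut
    valid_in_all_subst.

End LogicOf.

Definition extension_of (L0 L : logic) : Prop :=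
  forall Gamma phi, L0 Gamma phi -> L Gamma phi.

Definition finite_structure (M : structure) : Prop := finite_set [set: M].

Definition finitely_generated (L : logic) : Prop :=
  exists K : set structure,
    [/\ finite_set K,
        forall M, K M -> finite_structure M &
        forall Gamma phi, L Gamma phi <-> logic_of K Gamma phi].

Record De_Morgan_lattice (A : algebra) : Prop := DeMorganLattice {
  dm_meetC : forall x y : A, ameet x y = ameet y x;
  dm_joinC : forall x y : A, ajoin x y = ajoin y x;
  dm_meetA : forall x y z : A, ameet x (ameet y z) = ameet (ameet x y) z;
  dm_joinA : forall x y z : A, ajoin x (ajoin y z) = ajoin (ajoin x y) z;
  dm_meetK : forall x y : A, ameet x (ajoin x y) = x;
  dm_joinK : forall x y : A, ajoin x (ameet x y) = x;
  dm_meetU : forall x y z : A,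
    ameet x (ajoin y z) = ajoin (ameet x y) (ameet x z);
  dm_negK : forall x : A, aneg (aneg x) = x;
  dm_negI : forall x y : A, aneg (ameet x y) = ajoin (aneg x) (aneg y);
  dm_negU : forall x y : A, aneg (ajoin x y) = ameet (aneg x) (aneg y) }.

(* [ameet x y = x] is the lattice order x <= y. Requiring filters to be
   nonempty does not affect BD1: it has no theorems either way, and a rule with
   at least one premise is valid whenever the designated set is empty. *)
Definition lattice_filter (A : algebra) (F : set A) : Prop :=
  [/\ F !=set0,
      forall x y, F x -> ameet x y = x -> F y &
      forall x y, F x -> F y -> F (ameet x y)].

Definition BD1 : logic :=
  logic_of [set M : structure |
    De_Morgan_lattice M /\ lattice_filter (designated (s := M))].

(* The value on the empty list is junk. *)
Fixpoint bigOr (s : seq formula) : formula :=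
  match s with
  | [::] => Var 0
  | [:: phi] => phi
  | phi :: s' => Or phi (bigOr s')
  end.

(* [bigOr] is only applied to nonempty lists when 0 < n. *)
Definition PCP (n : nat) (L : logic) : Prop :=
  forall (Gamma : set formula) (phi : 'I_n.+1 -> formula) (psi : formula),
    (forall i : 'I_n.+1,
       L (Gamma `|` [set bigOr [seq phi j | j <- enum 'I_n.+1 & j != i]]) psi) ->
    L (Gamma `|` [set bigOr [seq phi j | j <- enum 'I_n.+1]]) psi.

Definition rule : Type := set formula * formula.

Definition finitary (r : rule) : Prop := finite_set r.1.

Definition validates (L : logic) (R : set rule) : Prop :=
  forall r, R r -> L r.1 r.2.

Definition smallest_logic (C : set logic) (L : logic) : Prop :=
  C L /\ forall L', C L' -> extension_of L L'.

(* Main.v *)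
Require Import Defs.
From mathcomp Require Import all_boot.
From mathcomp Require Import boolp classical_sets functions cardinality.

Local Open Scope classical_set_scope.

(** Let L' extend BD1 and have the n-PCP. If a finite Gamma does not entail psi
    in L', then Gamma extends by Zorn's lemma to a filter T of formulas closed
    under the finitary rules of L', omitting psi and n-prime. An n-prime filter
    is an intersection of n prime filters, and each prime filter of formulas is
    the preimage of the designated values under a homomorphism to the
    four-element De Morgan lattice DM4. So T is the preimage of the designated
    values under a homomorphism h to DM4^n, and valuations in the image of h
    lift to substitutions. Hence the finitary part of L' is determined by a set
    of substructures of DM4^n, of which there are finitely many. As L is
    finitary (compactness of finite structures), it suffices to put in R one
    finitary rule of L for each subset of DM4^n that refutes such a rule. *)

(** * Valuations, prime sets and maps to the four-element lattice *)

Fixpoint extend (A : algebra) (v : nat -> A) (phi : formula) : A :=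
  match phi with
  | Var k => v k
  | And phi psi => ameet (extend A v phi) (extend A v psi)
  | Or phi psi => ajoin (extend A v phi) (extend A v psi)
  | Neg phi => aneg (extend A v phi)
  end.
Arguments extend {A}.

Lemma extend_hom (A : algebra) (v : nat -> A) :
  homomorphism (extend v : formula_algebra -> A).
Proof. by split. Qed.

Lemma hom_extend (A B : algebra) (f : A -> B) (v : nat -> A) phi :
  homomorphism f -> f (extend v phi) = extend (f \o v) phi.
Proof.
by case=> fm fj fn; elim: phi => //= [a <- b <-|a <- b <-|a <-].
Qed.

Lemma extend_Var phi : extend (A := formula_algebra) Var phi = phi.
Proof. by elim: phi => //= [a -> b ->|a -> b ->|a ->]. Qed.

Lemma homE (A : algebra) (v : formula_algebra -> A) phi :
  homomorphism v -> v phi = extend (v \o Var) phi.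
Proof. by move=> hv; rewrite -{1}(extend_Var phi) hom_extend. Qed.

(* Neither nonempty nor proper: the empty set and the whole algebra qualify, so
   the theory of a logic without theorems needs no special treatment. *)
Record prime_set (A : algebra) (P : set A) : Prop := PrimeSet {
  primeI : forall x y, P (ameet x y) <-> P x /\ P y;
  primeU : forall x y, P (ajoin x y) <-> P x \/ P y;
  primeNN : forall x, P (aneg (aneg x)) <-> P x;
  primeNI : forall x y, P (aneg (ameet x y)) <-> P (aneg x) \/ P (aneg y);
  primeNU : forall x y, P (aneg (ajoin x y)) <-> P (aneg x) /\ P (aneg y) }.
Arguments prime_set {A}.

(* The four-element De Morgan lattice: the two coordinates of a value say
   whether it and its negation are designated. *)
Definition DM4 : algebra :=
  @Algebra (bool * bool) (fun x y => (x.1 && y.1, x.2 || y.2))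
    (fun x y => (x.1 || y.1, x.2 && y.2)) (fun x => (x.2, x.1))
    (inhabits (true, true)).

Definition prime_map {A : algebra} (P : set A) (x : A) : DM4 :=
  (`[< P x >], `[< P (aneg x) >]).

Lemma prime_map_hom {A : algebra} (P : set A) :
  prime_set P -> homomorphism (prime_map P).
Proof.
case=> pI pU pNN pNI pNU; split=> [x y|x y|x]; rewrite /prime_map /=.
- by rewrite (propext (pI x y)) (propext (pNI x y)) asbool_and asbool_or.
- by rewrite (propext (pU x y)) (propext (pNU x y)) asbool_and asbool_or.
- by rewrite (propext (pNN x)).
Qed.

(** * Separation by prime filters *)

Section PrimeSeparation.
Variable A : algebra.
Hypothesis dmA : De_Morgan_lattice A.

Let le (x y : A) := ameet x y = x.

Let meetxx (x : A) : ameet x x = x.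
Proof. by rewrite -{2}(dm_joinK dmA x x) dm_meetK. Qed.

Let le_trans x y z : le x y -> le y z -> le x z.
Proof. by rewrite /le => xy yz; rewrite -xy -(dm_meetA dmA) yz. Qed.

Let le_meetl x y : le (ameet x y) x.
Proof. by rewrite /le (dm_meetC dmA x) -(dm_meetA dmA) meetxx. Qed.

Let le_meetr x y : le (ameet x y) y.
Proof. by rewrite (dm_meetC dmA); apply: le_meetl. Qed.

Let le_meet x y z : le z x -> le z y -> le z (ameet x y).
Proof. by rewrite /le => zx zy; rewrite (dm_meetA dmA) zx. Qed.

Let le_joinl x y : le x (ajoin x y).
Proof. exact: dm_meetK. Qed.

Let le_joinr x y : le y (ajoin x y).
Proof. by rewrite (dm_joinC dmA); apply: le_joinl. Qed.

Let le_join x y z : le x z -> le y z -> le (ajoin x y) z.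
Proof.
by rewrite /le => xz yz; rewrite (dm_meetC dmA) (dm_meetU dmA)
  !(dm_meetC dmA z) xz yz.
Qed.

(** A filter maximal among those containing [y] and omitting [x] is prime by distributivity; the
    negation clauses follow from the De Morgan laws. *)
Lemma prime_separation (x y : A) :
  ameet y x <> y -> exists P : set A, [/\ prime_set P, P y & ~ P x].
Proof.
move=> nyx.
(* The clause [X a -> X y] admits the empty set, the union of the empty chain; maximality then
   forces [P y]. *)
pose proper X := [/\ forall a b, X a -> le a b -> X b,
  forall a b, X a -> X b -> X (ameet a b), forall a, X a -> X y & ~ X x].
have [F sF totF|P [[Pup PI Py Px] Pmax]] := @Zorn_bigcup A proper.
  split=> [a b [X FX Xa] ab|a b [X FX Xa] [Y FY Yb]|a [X FX Xa]|[X FX Xx]].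
  - by exists X => //; have [up _ _ _] := sF X FX; apply: up Xa ab.
  - have [XY|YX] := totF X Y FX FY.
      by exists Y => //; have [_ + _ _] := sF Y FY; apply=> //; apply: XY.
    by exists X => //; have [_ + _ _] := sF X FX; apply=> //; apply: YX.
  - by exists X => //; have [_ _ + _] := sF X FX; apply; exact: Xa.
  - by have [_ _ _] := sF X FX.
have Py' : P y.
  apply: contrapT => nPy; apply: (Pmax [set a | le y a]).
    split=> [a /Py //|]; move=> /(_ y) sYP; apply/nPy/sYP; exact: meetxx.
  split=> [a b|a b ya yb|_ _|].
  - exact: le_trans.
  - exact: le_meet.
  - exact: meetxx.
  - exact: nyx.
have adjoin a : ~ P a -> exists2 t, P t & le (ameet t a) x.
  move=> nPa; apply: contrapT => nt.
  apply: (Pmax [set c | exists2 t, P t & le (ameet t a) c]).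
    split=> [c Pc|sP]; first by exists c => //; apply: le_meetl.
    by apply/nPa/sP; exists y => //; apply: le_meetr.
  split=> //= [b c [t Pt tb] bc|b c [t Pt tb] [s Ps sc]|_ _].
  - by exists t => //; apply: le_trans tb bc.
  - exists (ameet t s); first exact: PI.
    apply: le_meet; [apply: le_trans tb|apply: le_trans sc]; apply: le_meet.
    + exact: le_trans (le_meetl _ _) (le_meetl _ _).
    + exact: le_meetr.
    + exact: le_trans (le_meetl _ _) (le_meetr _ _).
    + exact: le_meetr.
  - by exists y => //; apply: le_meetl.
have PIE a b : P (ameet a b) <-> P a /\ P b.
  split=> [Pab|[]]; last exact: PI.
  by split; apply: Pup Pab _; [apply: le_meetl|apply: le_meetr].
have PUE a b : P (ajoin a b) <-> P a \/ P b.
  split=> [Pab|[Pa|Pb]]; last 2 first.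
  - by apply: Pup Pa _; apply: le_joinl.
  - by apply: Pup Pb _; apply: le_joinr.
  apply: contrapT => /not_orP [/adjoin [t Pt ta] /adjoin [s Ps sb]].
  apply/Px/(Pup (ameet (ameet t s) (ajoin a b))); first exact: PI (PI _ _ Pt Ps) Pab.
  rewrite (dm_meetU dmA); apply: le_join.
  - apply: le_trans ta; apply: le_meet (le_meetr _ _).
    exact: le_trans (le_meetl _ _) (le_meetl _ _).
  - apply: le_trans sb; apply: le_meet (le_meetr _ _).
    exact: le_trans (le_meetl _ _) (le_meetr _ _).
exists P; split=> //; split=> // [a|a b|a b].
- by rewrite (dm_negK dmA).
- by rewrite (dm_negI dmA).
- by rewrite (dm_negU dmA).
Qed.

End PrimeSeparation.

(** * Completeness of [BD1] for [DM4] *)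

Definition holds (e : nat -> DM4) (phi : formula) : bool := (extend e phi).1.

Lemma holds_And e a b : holds e (And a b) = holds e a && holds e b.
Proof. by []. Qed.

Lemma holds_Or e a b : holds e (Or a b) = holds e a || holds e b.
Proof. by []. Qed.

Definition holdsE := (holds_And, holds_Or).

(** A prime set separating [v phi] from [v psi] would turn [v] into a valuation in [DM4] that
    contradicts the hypothesis. *)
Lemma BD1_complete (phi psi : formula) :
  (forall e, holds e phi -> holds e psi) -> BD1 [set phi] psi.
Proof.
move=> le_phi_psi M [dmM [_ Fup _]] v hv vphi.
have {}vphi : designated (s := M) (v phi) by apply: vphi; exists phi.
apply: (Fup _ _ vphi); apply: contrapT => /(prime_separation _ dmM).
case=> P [prP Pphi nPpsi]; apply: nPpsi.
have := le_phi_psi (prime_map P \o v \o Var).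
rewrite /holds.
have E a : extend (prime_map P \o v \o Var) a = prime_map P (v a).
  by rewrite (homE _ v) // hom_extend //; apply: prime_map_hom.
by rewrite !E /= => h; apply/asboolP/h/asboolP.
Qed.

Lemma BD1_And (phi psi : formula) : BD1 ([set phi] `|` [set psi]) (And phi psi).
Proof.
move=> M [dmM [_ _ FI]] v [vm _ _] vF; rewrite vm; apply: FI; apply: vF.
  by exists phi => //; left.
by exists psi => //; right.
Qed.

(** * Compactness and finitarity *)

(** König's argument: a countermodel is built one variable at a time, and finiteness of [M] provides
    a next value that keeps every finite part of [Gamma] refutable. *)
Lemma finite_structure_compact (M : structure) (Gamma : set formula) phi :
  finite_structure M -> valid M Gamma phi ->
  exists Delta, [/\ finite_set Delta, Delta `<=` Gamma & valid M Delta phi].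
Proof.
move=> finM Gphi; apply: contrapT => nfin.
(* [ok k w]: no finite subset of Gamma prevents the first k values of w from
   extending to a countermodel. *)
pose refutes (v : nat -> M) Delta :=
  (forall d, Delta d -> designated (s := M) (extend v d)) /\ ~ designated (s := M) (extend v phi).
pose ok k (w : nat -> M) := forall Delta, finite_set Delta -> Delta `<=` Gamma ->
  exists2 v, refutes v Delta & forall j, j < k -> v j = w j.
have [x0] := alg_nonempty M.
have ok0 : ok 0 (fun=> x0).
  move=> Delta finD sD; apply: contrapT => nv; apply: nfin; exists Delta.
  split=> // v hv vD; apply: contrapT => nphi; apply: nv.
  exists (v \o Var) => //; split=> [d Dd|]; rewrite -homE //.
  by apply: vD; exists d.
pose upd k (w : nat -> M) m j := if j == k then m else w j.
(* If every value [m] fails, the union of the obstructions [D m] is finite, yet its countermodel [v]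
   is excluded by [D (v k)]. *)
have step kw : exists m, ok kw.1 kw.2 -> ok kw.1.+1 (upd kw.1 kw.2 m).
  case: kw => k w /=; apply: contrapT => /forallNP bad.
  have okw : ok k w by apply: contrapT => nok; apply: (bad x0).
  have {}bad m : exists Delta, [/\ finite_set Delta, Delta `<=` Gamma &
      forall v, refutes v Delta -> (forall j, j < k -> v j = w j) -> v k <> m].
    apply: contrapT => nD; apply: (bad m) => _ Delta finD sD.
    apply: contrapT => nv; apply: nD; exists Delta; split=> // v rv vw vk.
    apply: nv; exists v => // j; rewrite ltnS leq_eqVlt /upd.
    by case: eqP => [-> _|_ /= /vw].
  have [D hD] := choice bad.
  have [||v rv vw] := okw (\bigcup_(m in [set: M]) D m).
  - by apply: bigcup_finite => // m _; have [] := hD m.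
  - by move=> d [m _ Dd]; have [_ + _] := hD m; apply.
  have [_ _ /(_ v)] := hD (v k); apply=> //; case: rv => vD vphi; split=> // d Dd.
  by apply: vD; exists (v k).
have [f hf] := choice step.
pose ws := fix ws k := if k is j.+1 then upd j (ws j) (f (j, ws j)) else fun=> x0.
have okws k : ok k (ws k) by elim: k => //= k IH; apply: (hf (k, ws k)).
(* Stage [j.+1] fixes the value of variable [j] for good, so [u] is the limit of the stages. *)
pose u j := ws j.+1 j.
have wsu k j : j < k -> ws k j = u j.
  elim: k => // k IH; rewrite ltnS leq_eqVlt /= {1}/upd.
  by case: eqP => [->|_ /= /IH] //; rewrite /u /= /upd eqxx.
have local psi : exists k, forall v : nat -> M,
    (forall j, j < k -> v j = u j) -> extend v psi = extend u psi.
  elim: psi => [j|a [k hk] b [l hl]|a [k hk] b [l hl]|a [k hk]].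
  - by exists j.+1 => v; apply.
  - exists (maxn k l) => v hv /=.
    by rewrite hk ?hl // => j jk; apply: hv; rewrite leq_max jk ?orbT.
  - exists (maxn k l) => v hv /=.
    by rewrite hk ?hl // => j jk; apply: hv; rewrite leq_max jk ?orbT.
  - by exists k => v hv /=; rewrite hk.
have [l hl] := local phi.
have [v [_ vphi] vw] := okws l set0 (finite_set0 _) (@sub0set _ _).
apply: vphi; rewrite hl => [|j jl]; last by rewrite vw ?wsu.
apply: (Gphi (extend u) (extend_hom _ _)) => _ [d Gd <-].
have [k hk] := local d.
have [||{}v [vd _] {}vw] := okws k [set d]; first exact: finite_set1.
  by move=> ? ->.
by rewrite -(hk v) => [|j jk]; [apply: vd | rewrite vw ?wsu].
Qed.

(** Each of the finitely many generating structures contributes a finite set of premises; the union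
    serves all of them. *)
Lemma finitely_generated_finitary (L : logic) (Gamma : set formula) phi :
  finitely_generated L -> L Gamma phi ->
  exists Delta, [/\ finite_set Delta, Delta `<=` Gamma & L Delta phi].
Proof.
case=> K [finK finM LK] /LK Gphi.
have /choice[D hD] M : exists Delta, [/\ finite_set Delta, Delta `<=` Gamma &
    K M -> valid M Delta phi].
  have [KM|nKM] := pselect (K M); last by exists set0; split.
  have [Delta []] := @finite_structure_compact M Gamma phi (finM M KM) (Gphi M KM).
  by exists Delta; split.
exists (\bigcup_(M in K) D M); split.
- by apply: bigcup_finite => // M _; have [] := hD M.
- by move=> d [M _ Dd]; have [_ + _] := hD M; apply.
- apply/LK => M KM; have [_ _ /(_ KM)] := hD M.
  move=> Dphi v hv vD; apply: Dphi => // _ [d Dd <-].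
  by apply: vD; exists d => //; exists M.
Qed.

(** * Disjunctions and n-prime filters *)

Notation bigOr_all phi := (bigOr [seq phi j | j <- enum 'I__]).
Notation bigOr_but phi i := (bigOr [seq phi j | j <- enum 'I__ & j != i]).

Lemma holds_bigOr e s : 0 < size s -> holds e (bigOr s) = has (holds e) s.
Proof.
elim: s => //= a [|b s] IH _ /=; first by rewrite orbF.
by rewrite holds_Or IH.
Qed.

Lemma holds_bigOr_all k e (phi : 'I_k.+1 -> formula) :
  holds e (bigOr_all phi) = [exists j, holds e (phi j)].
Proof.
rewrite holds_bigOr ?has_map; last by rewrite size_map size_enum_ord.
by apply/hasP/existsP => [[j _ hj]|[j hj]]; exists j; rewrite ?mem_enum.
Qed.

Lemma holds_bigOr_but k e (phi : 'I_k.+2 -> formula) i :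
  holds e (bigOr_but phi i) = [exists (j | j != i), holds e (phi j)].
Proof.
rewrite holds_bigOr ?has_map.
  apply/hasP/existsP => [[j ji hj]|[j /andP[ji hj]]]; exists j => //.
    by apply/andP; split=> //; move: ji; rewrite mem_filter => /andP[].
  by rewrite mem_filter mem_enum andbT.
(* With at least two indices, one differs from [i], which avoids the junk value of [bigOr]. *)
rewrite size_map size_filter -has_count; apply/hasP; exists (lift i ord0).
  by rewrite mem_enum.
by rewrite eq_sym neq_lift.
Qed.

(** The order is that of [DM4], so that membership steps become boolean computations; [BD1_complete]
    will supply this closure. *)
Definition sem_filter (T : set formula) : Prop :=
  (forall a b, T a -> (forall e, holds e a -> holds e b) -> T b) /\
  (forall a b, T a -> T b -> T (And a b)).

Definition nprime (n : nat) (T : set formula) : Prop :=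
  forall phi : 'I_n.+1 -> formula,
    T (bigOr_all phi) -> exists i, T (bigOr_but phi i).

(** The negation clauses hold because the De Morgan and double negation laws hold in [DM4] in both
    directions. *)
Lemma prime_sem_filter (P : set formula) : sem_filter P ->
  (forall a b, P (Or a b) -> P a \/ P b) ->
  prime_set (A := formula_algebra) P.
Proof.
move=> [Pup PI] Pprime.
have PIE a b : P (And a b) <-> P a /\ P b.
  split=> [Pab|[]]; last exact: PI.
  by split; apply: Pup Pab _ => e; rewrite holdsE => /andP[].
have PUE a b : P (Or a b) <-> P a \/ P b.
  split; first exact: Pprime.
  by case=> [Pa|Pb]; [apply: Pup Pa _|apply: Pup Pb _] => e;
    rewrite holdsE => ->; rewrite ?orbT.
split=> // [a|a b|a b] /=.
- by split=> /Pup; apply=> e; rewrite /holds /=.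
- by rewrite -PUE; split=> /Pup; apply=> e; rewrite /holds /=.
- by rewrite -PIE; split=> /Pup; apply=> e; rewrite /holds /=.
Qed.

Lemma sem_filter_foldr T t (I : Type) (F : I -> formula) s : sem_filter T ->
  T t -> (forall i, T (F i)) -> T (foldr And t [seq F i | i <- s]).
Proof. by move=> [_ TI] Tt TF; elim: s => //= i s IH; apply: TI. Qed.

Lemma holds_foldr e t (I : Type) (F : I -> formula) s :
  holds e (foldr And t [seq F i | i <- s]) =
  holds e t && all (fun i => holds e (F i)) s.
Proof. by elim: s => [|i s IH]; rewrite ?andbT //= holdsE IH andbCA. Qed.

Lemma nprime_Or k (T : set formula) (f : 'I_k.+2 -> formula) g :
  sem_filter T -> nprime k.+2 T -> T (Or g (bigOr_all f)) ->
  T (bigOr_all f) \/ exists i, T (Or g (bigOr_but f i)).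
Proof.
move=> [Tup _] Tprime Tgf.
pose h (j : 'I_k.+3) := if unlift ord_max j is Some j' then f j' else g.
have hl j : h (lift ord_max j) = f j by rewrite /h liftK.
have hm : h ord_max = g by rewrite /h unlift_none.
case: (Tprime h) => [|i].
  apply: Tup Tgf _ => e; rewrite holdsE !holds_bigOr_all.
  case/orP=> [gh|/existsP[j fj]]; apply/existsP.
    by exists ord_max; rewrite hm.
  by exists (lift ord_max j); rewrite hl.
case: (unliftP ord_max i) => [j ->|->] Thi; [right; exists j|left];
  apply: Tup Thi _ => e; rewrite ?holdsE ?holds_bigOr_all !holds_bigOr_but;
  case/existsP=> j' /andP[].
- case: (unliftP ord_max j') => [l ->|->]; rewrite ?hl ?hm; last by move=> _ ->.
  rewrite (inj_eq lift_inj) => lj fl; apply/orP; right; apply/existsP.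
  by exists l; rewrite lj.
- case: (unliftP ord_max j') => [l ->|->]; rewrite ?eqxx // hl => _ fl.
  by apply/existsP; exists l.
Qed.

(* If T is k-prime but phi witnesses that it is not (k-1)-prime, then T is the
   intersection of the k prime filters { x | x \/ OR_(j <> i) phi j \in T }. *)
Lemma nprime_decomposition n (T : set formula) :
  0 < n -> sem_filter T -> nprime n T ->
  exists P : 'I_n -> set formula,
    (forall i, prime_set (A := formula_algebra) (P i)) /\
    (forall x, T x <-> forall i, P i x).
Proof.
case: n => // n _ filT; have [Tup TI] := filT; elim: n => [|n IH] Tprime.
  exists (fun=> T); split=> [_|x]; last by split=> // /(_ ord0).
  apply: prime_sem_filter => // a b Tab.
  pose f (j : 'I_2) := if j == ord0 then a else b.
  have [|i] := Tprime f.
    apply: Tup Tab _ => e; rewrite holdsE holds_bigOr_all.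
    case/orP=> h; apply/existsP; first by exists ord0.
    by exists ord_max.
  have [->|i0] := eqVneq i ord0 => Ti; [right|left];
    apply: Tup Ti _ => e; rewrite holds_bigOr_but => /existsP[j /andP[]].
  - by rewrite /f => /negPf ->.
  - rewrite /f; have [//|j0 ji] := eqVneq j ord0; exfalso; move: ji j0 i0.
    by case: j => [[|[|?]]] //= ?; case: i => [[|[|?]]].
have [/IH [P [prP TP]]|/existsNP[phi /not_implyP[Tphi /forallNP Tbut]]] :=
  pselect (nprime n.+1 T).
  (* Repeating [P ord0] pads the family by one. *)
  exists (fun i => P (odflt ord0 (unlift ord0 i))).
  split=> // x; rewrite TP; split=> [Px i //|Px j].
  by have := Px (lift ord0 j); rewrite liftK.
pose d i := bigOr_but phi i.
have phi_le_but e i j : j != i -> holds e (phi j) -> holds e (d i).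
  by move=> ji phij; rewrite holds_bigOr_but; apply/existsP; exists j; rewrite ji.
exists (fun i => [set x | T (Or x (d i))]); split=> [i|x].
  apply: prime_sem_filter => [|x y /= Txy].
    split=> [a b Ta ab|a b Ta Tb] /=.
      by apply: Tup Ta _ => e; rewrite !holdsE => /orP[/ab ->|->] //; rewrite orbT.
    apply: Tup (TI _ _ Ta Tb) _ => e.
    by rewrite !holdsE -orb_andl.
  (* By distributivity [T] contains the disjunction of [And y (phi i)], [And x (phi i)] and the
     other [phi j]. Dropping the first yields [Or x (d i)], dropping the second [Or y (d i)], and
     dropping another [phi j] a formula below [d j], which is not in [T]. *)
  pose f j := if j == i then And x (phi i) else phi j.
  have [|Tf|[j]] := @nprime_Or n T f (And y (phi i)) filT Tprime.
  - apply: Tup (TI _ _ Txy Tphi) _ => e.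
    rewrite !holdsE !holds_bigOr_all => /andP[xyd /existsP[j phij]].
    have := xyd; rewrite holds_bigOr_but.
    have [ji|ji] := eqVneq j i.
      rewrite ji in phij; rewrite phij andbT.
      case: (holds e y) => //=; rewrite ?orbT // orbF => /orP[hx|].
        by apply/existsP; exists i; rewrite /f eqxx holdsE hx.
      case/existsP=> l /andP[li phil]; apply/existsP; exists l.
      by rewrite /f (negPf li).
    by move=> _; apply/orP; right; apply/existsP; exists j; rewrite /f (negPf ji).
  - left; apply: Tup Tf _ => e; rewrite holds_bigOr_all holdsE => /existsP[j].
    rewrite /f; case: eqP => [_|/eqP ji phij].
      by rewrite holdsE => /andP[->].
    by rewrite (phi_le_but e i j) ?orbT.
  have [->|ji] := eqVneq j i => Tj.
    right; apply: Tup Tj _ => e; rewrite !holdsE holds_bigOr_but.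
    case/orP=> [/andP[->]//|/existsP[l /andP[li]]].
    by rewrite /f (negPf li) => /(phi_le_but e i l li) ->; rewrite orbT.
  exfalso; apply/(Tbut j)/(Tup _ _ Tj) => e; rewrite holdsE holds_bigOr_but.
  have phii : holds e (phi i) -> holds e (d j) by apply: phi_le_but; rewrite eq_sym.
  case/orP=> [/andP[_ /phii]//|/existsP[l /andP[lj]]].
  rewrite /f; case: eqP => [_|_]; first by case/andP=> _ /phii.
  exact: phi_le_but.
split=> [Tx i|Px] /=.
  by apply: Tup Tx _ => e; rewrite holdsE => ->.
(* By distributivity [Or c (bigOr_all f)] is in [T]. Dropping [c] leaves a formula below [x];
   dropping [f i] leaves one below [d i], which is not in [T]. *)
pose c := foldr And (bigOr_all phi) [seq d i | i <- enum 'I_n.+2].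
pose f j := And x (phi j).
have [|Tf|[i Ti]] := @nprime_Or n T f c filT Tprime.
- have := @sem_filter_foldr T _ _ (fun i => Or x (d i)) (enum 'I_n.+2) filT Tphi Px.
  move=> /Tup; apply=> e; rewrite /c holdsE !holds_foldr !holds_bigOr_all.
  case/andP=> phij /allP xd; rewrite phij /=.
  have [hx|nx] := boolP (holds e x).
    by apply/orP; right; case/existsP: phij => j hj; apply/existsP; exists j;
      rewrite /f holdsE hx.
  apply/orP; left; apply/allP => i /xd; by rewrite holdsE (negPf nx).
- by apply: Tup Tf _ => e; rewrite holds_bigOr_all => /existsP[j /andP[]].
- exfalso; apply/(Tbut i)/(Tup _ _ Ti) => e; rewrite holdsE holds_foldr.
  case/orP=> [/andP[_ /allP]|]; first by apply; rewrite mem_enum.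
  rewrite holds_bigOr_but => /existsP[j /andP[ji /andP[_]]].
  exact: phi_le_but.
Qed.

(** * Maximal theories *)

(** Finitely many members of a chain lie in the largest of them; the left alternative accounts for
    the empty chain. *)
Lemma finite_chain_union (X : Type) (G : set X) (F : set (set X)) (D : set X) :
  total_on F subset -> finite_set D -> D `<=` G `|` \bigcup_(Y in F) Y ->
  D `<=` G \/ exists2 Y, F Y & D `<=` G `|` Y.
Proof.
elim/Pchoice: X => X in G F D *.
move=> totF /finite_seqP[s ->]; elim: s => [|x s IH] sD; first by left.
have [|sG|[Y FY sY]] := IH.
- by move=> y ys; apply: sD; rewrite /= inE ys orbT.
- have [|Gx|[Y FY Yx]] := sD x; first by rewrite /= inE eqxx.
    by left=> y; rewrite /= inE => /orP[/eqP->|/sG].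
  by right; exists Y => // y; rewrite /= inE => /orP[/eqP->|/sG]; [right|left].
- right; have [|Gx|[Z FZ Zx]] := sD x; first by rewrite /= inE eqxx.
    by exists Y => // y; rewrite /= inE => /orP[/eqP->|/sY]; [left|].
  have [YZ|ZY] := totF Y Z FY FZ.
    exists Z => // y; rewrite /= inE => /orP[/eqP->|/sY[|/YZ]]; by [right|left|right].
  exists Y => // y; rewrite /= inE => /orP[/eqP->|/sY //]; by right; apply: ZY.
Qed.

(** [T] is a maximal set avoiding [psi]. Were no [bigOr_but phi i] in [T], each would yield [psi]
    with finitely many premises from [Gamma] and [T], and by the PCP so would the full
    disjunction. *)
Lemma nprime_theory (n : nat) (L : logic) (Gamma : set formula) psi :
  PCP n L -> ~ L Gamma psi -> exists T : set formula,
  [/\ Gamma `<=` T, ~ T psi, nprime n T &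
      forall Delta x, finite_set Delta -> Delta `<=` T -> L Delta x -> T x].
Proof.
move=> L_PCP nGpsi.
(* [L] may fail to be finitary, so only finite premise sets are tested, which lets the property pass
   to unions of chains. Adjoining [Gamma] to [X] covers the empty chain. *)
pose avoids X := forall Delta, finite_set Delta -> Delta `<=` Gamma `|` X ->
  ~ L Delta psi.
have [F sF totF|T [avT maxT]] := @Zorn_bigcup _ avoids.
  move=> Delta finD sD; have [sG|[Y FY sY]] := finite_chain_union _ _ _ _ totF finD sD.
    by move=> /(entails_mono sG).
  exact: (sF Y FY).
have out x : ~ T x -> exists Delta,
    [/\ finite_set Delta, Delta `<=` Gamma `|` T & L (Delta `|` [set x]) psi].
  move=> nTx; apply: contrapT => nD; apply: (maxT (T `|` [set x])).
    by split=> [y|/(_ x)]; [left | move=> sT; apply/nTx/sT; right].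
  move=> Delta finD sD Dpsi; apply: nD; exists (Delta `\ x).
  split=> [|y [/sD]|]; first exact: finite_setD.
    by move=> [Gy|[Ty|/= ->]] // _; [left|right].
  apply: entails_mono Dpsi => y Dy.
  by have [->|yx] := pselect (y = x); [right|left].
have closed Delta x : finite_set Delta -> Delta `<=` Gamma `|` T -> L Delta x -> T x.
  move=> finD sD Dx; apply: contrapT => /out [D' [finD' sD' D'psi]].
  apply: (avT (Delta `|` D')); first by rewrite finite_setU.
    by move=> y [/sD|/sD'].
  apply: entails_cut D'psi => y [D'y|->]; first by apply: entails_refl; right.
  by apply: entails_mono Dx => z; left.
exists T; split=> [x Gx|Tpsi|phi Tphi|Delta x finD sD].
- apply: (closed [set x]); first exact: finite_set1; first by move=> _ ->; left.
  exact: entails_refl.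
- apply: (avT [set psi]); first exact: finite_set1; first by move=> _ ->; right.
  exact: entails_refl.
- apply: contrapT => /forallNP nT.
  have /choice[D hD] i := out _ (nT i).
  pose Delta := \bigcup_(i in [set: 'I_n.+1]) D i.
  apply: (avT (Delta `|` [set bigOr_all phi])).
  + rewrite finite_setU; split; last exact: finite_set1.
    by apply: bigcup_finite => // i _; have [] := hD i.
  + by move=> y [[i _ Dy]|->]; [have [_ + _] := hD i; apply|right].
  + apply: L_PCP => i; have [_ _] := hD i; apply: entails_mono.
    by move=> y [Dy|->]; [left; exists i|right].
- by apply: closed => // y /sD; right.
Qed.

(** * The finite set of rules *)

(* B stands for the substructure of the n-th power of (DM4, holds) that it
   generates: only the values of the variables are required to lie in B. *)
Definition refuted_in {n} (B : {set {ffun 'I_n -> bool * bool}}) (r : rule) : Prop :=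
  exists v : nat -> {ffun 'I_n -> bool * bool},
    [/\ forall k, v k \in B,
        forall g, r.1 g -> forall i, holds (v^~ i) g &
        exists i, ~~ holds (v^~ i) r.2].

Theorem mainTheorem14 (n : nat) (hn : (1 <= n)%N) (L : logic)
    (L_fg : finitely_generated L) (L_ext : extension_of BD1 L) (L_PCP : PCP n L) :
  exists R : set rule,
    [/\ finite_set R,
        forall r, R r -> finitary r &
        smallest_logic
          [set L' : logic | [/\ extension_of BD1 L', PCP n L' & validates L' R]] L].
Proof.
have /choice[r hr] (B : {set {ffun 'I_n -> bool * bool}}) : exists r : rule,
    [/\ finitary r, L r.1 r.2 & forall s : rule,
        finitary s -> L s.1 s.2 -> refuted_in B s -> refuted_in B r].
  have [[r [finr Lr rB]]|nr] := pselect (exists r : rule,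
    [/\ finitary r, L r.1 r.2 & refuted_in B r]); first by exists r; split.
  (* Default when no finitary rule of [L] is refuted in [B]; the last clause is then vacuous. *)
  exists ([set Var 0], Var 0); split; first exact: finite_set1.
    exact: entails_refl.
  by move=> s fins Ls sB; case: nr; exists s.
exists (range r); split.
- exact/finite_image/finite_finset.
- by move=> _ [B _ <-]; have [] := hr B.
split=> [|L' [L'_ext L'_PCP L'R] Gamma psi Gpsi].
  by split=> // _ [B _ <-]; have [] := hr B.
have [Delta [finD sD {}Gpsi]] := finitely_generated_finitary L Gamma psi L_fg Gpsi.
apply: (entails_mono sD); apply: contrapT => nDpsi.
have [T [DT nTpsi Tprime Tclosed]] :=
  nprime_theory n L' Delta psi L'_PCP nDpsi.
have filT : sem_filter T.
  split=> [a b Ta ab|a b Ta Tb].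
    apply: (Tclosed [set a]); [exact: finite_set1|by move=> _ ->|].
    exact/L'_ext/BD1_complete.
  apply: (Tclosed ([set a] `|` [set b])).
  - by rewrite finite_setU; split; apply: finite_set1.
  - by move=> _ [->|->].
  - exact/L'_ext/BD1_And.
have [P [prP TP]] := nprime_decomposition n T hn filT Tprime.
pose h (x : formula) : {ffun 'I_n -> bool * bool} :=
  [ffun i => prime_map (A := formula_algebra) (P i) x].
have holds_h (sigma : nat -> formula) x i :
    holds (fun k => h (sigma k) i) x <->
    P i (extend (A := formula_algebra) sigma x).
  have -> : (fun k => h (sigma k) i) =
      prime_map (A := formula_algebra) (P i) \o sigma.
    by apply/funext => k; rewrite /= ffunE.
  rewrite /holds -hom_extend; last exact: prime_map_hom.
  by split=> /asboolP.
(* [B] is the image of [h]. There [h] on the variables refutes [(Delta, psi)], so [r B] is refuted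
   as well. *)
pose B := [set u | `[< exists x, h x = u >]]%SET.
have [finr Lr rB] := hr B.
have [v [vB vr [i nvr]]] : refuted_in B (r B).
  apply: (rB (Delta, psi)) => //; exists (h \o Var); split=> [k|g Dg i|] /=.
  - by rewrite inE; apply/asboolP; exists (Var k).
  - by rewrite holds_h extend_Var; apply/(TP g).1/DT.
  - apply: contrapT => /forallNP hpsi; apply/nTpsi/TP => i.
    rewrite -[psi]extend_Var -holds_h; exact/negPn/negP/hpsi.
(* Values in [B] lift to formulas, so the refuting valuation is [h] after a substitution [sigma].
   Then [T] contains the instances of the premises of [r B], hence that of its conclusion, against
   [nvr]. *)
have /choice[sigma hsigma] k : exists x, h x = v k.
  by have := vB k; rewrite inE => /asboolP.
have vE : v = h \o sigma by apply/funext => k; rewrite /= hsigma.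
subst v; have Trule : T (extend (A := formula_algebra) sigma (r B).2).
  apply: (Tclosed [set extend (A := formula_algebra) sigma x | x in (r B).1]).
  - exact: finite_image.
  - by move=> _ [x rx <-]; apply/TP => j; apply/holds_h/vr.
  - have L'r : L' (r B).1 (r B).2 by apply: L'R; exists B.
    exact: (entails_subst (extend_hom formula_algebra sigma) L'r).
by move/negP: nvr; apply; apply/holds_h; move: i; apply/TP.
Qed.
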